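(* Let $M$ be a lightlike surface of Minkowski space $\mathbb{R}^3_1$, equipped with a chosen screen distribution $S(TM)$ and the associated lightlike transversal bundle $tr(TM)$. Then $M$ has degenerate planar normal sections.
   Context: $\mathbb{R}^3_1$ is $\mathbb{R}^3$ with the flat metric $\bar g$ of signature $(-,+,+)$, and $\bar\nabla$ is its Levi-Civita connection. A surface $M\subset\mathbb{R}^3_1$ is lightlike if $Rad\,T_xM = T_xM\cap T_xM^{\perp}\neq\{0\}$ for every $x\in M$; then $Rad\,TM=TM^{\perp}$ is a rank-one distribution on $M$, locally spanned by a nowhere zero lightlike vector field $\xi$ with $\bar g(\xi,X)=0$ for all $X$ tangent to $M$. A screen distribution $S(TM)$ is a complementary vector bundle of $Rad\,TM$ in $TM$, so $TM=Rad\,TM\oplus_{orth}S(TM)$; it is non-degenerate (here of rank one and spacelike). Given $S(TM)$, there is a unique rank-one vector bundle $tr(TM)$ over $M$ such that for each local nowhere zero section $\xi$ of $TM^\perp$ there is a unique local section $N$ of $tr(TM)$ with $\bar g(N,\xi)=1$, $\bar g(N,N)=0$, and $\bar g(N,W)=0$ for all $W\in\Gamma(S(TM))$; one has $T\mathbb{R}^3_1|_M=TM\oplus tr(TM)$. Degenerate normal sections: for $p\in M$ and a lightlike vector $\xi$ spanning the radical distribution at $p$, the vector $\xi$ and the transversal space $tr(TM)$ at $p$ determine a 2-dimensional (affine) subspace $E(p,\xi)$ of $\mathbb{R}^3_1$ through $p$. The intersection of $M$ and $E(p,\xi)$ gives a lightlike curve $\gamma$ in a neighborhood of $p$, called the normal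 section of $M$ at $p$ in the direction of $\xi$ (with $\gamma'=\xi$ along $\gamma$). $M$ is said to have degenerate (pointwise) planar normal sections if, for each $p\in M$, each such normal section $\gamma$ at $p$ satisfies $\gamma'\wedge\gamma''\wedge\gamma'''=0$ at $p$, where derivatives are taken in $\mathbb{R}^3_1$ (i.e. $\gamma''=\bar\nabla_{\gamma'}\gamma'$, etc.); that is, $\gamma',\gamma'',\gamma'''$ are linearly dependent at $p$. *)

(* Defs.v *)
From HB Require Import structures.
From mathcomp Require Import all_boot all_order all_algebra.
From mathcomp Require Import all_classical all_reals all_analysis.
Set Implicit Arguments.
Unset Strict Implicit.
Unset Printing Implicit Defensive.
Import Order.TTheory GRing.Theory Num.Theory.
Import numFieldNormedType.Exports.
Local Open Scope classical_set_scope.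
Local Open Scope ring_scope.

(* C^n on an open set U: for n > 0, f is differentiable on U and its
   derivative along every fixed vector is C^(n-1) on U. *)
Fixpoint Cn_on (R : realType) (V W : normedModType R) (n : nat)
    (U : set V) (f : V -> W) : Prop :=
  match n with
  | 0 => forall x, U x -> {for x, continuous f}
  | m.+1 => (forall x, U x -> differentiable f x) /\
            (forall v, Cn_on m U (fun x => 'D_v f x))
  end.

Definition smooth_on (R : realType) (V W : normedModType R)
    (U : set V) (f : V -> W) : Prop := forall n, Cn_on n U f.

Section Geometry.
Variable R : realType.

Definition lorentz_form (u v : 'rV[R]_3) : R :=
  - (u 0 0 * v 0 0) + u 0 1 * v 0 1 + u 0 2%:R * v 0 2%:R.

Definition orthogonal_space (A : set 'rV[R]_3) : set 'rV[R]_3 :=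
  [set v | forall w, A w -> lorentz_form v w = 0].

Definition line (v : 'rV[R]_3) : set 'rV[R]_3 := [set c *: v | c in setT].

(* Regular local parametrization of M by the open subset U of R^2: a smooth
   immersion that is a homeomorphism onto a relatively open subset of M. *)
Definition local_parametrization (M : set 'rV[R]_3)
    (U : set 'rV[R]_2) (phi : 'rV[R]_2 -> 'rV[R]_3) : Prop :=
  [/\ open U,
      smooth_on U phi,
      forall x, U x -> injective ('d phi x),
      exists2 W : set 'rV[R]_3, open W & phi @` U = M `&` W
    & exists psi : 'rV[R]_3 -> 'rV[R]_2,
        (forall x, U x -> psi (phi x) = x) /\
        {within phi @` U, continuous psi}].

Definition surface (M : set 'rV[R]_3) : Prop :=
  forall p, M p -> exists U phi, local_parametrization M U phi /\ (phi @` U) p.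

Definition tangent_space (M : set 'rV[R]_3) (p : 'rV[R]_3) : set 'rV[R]_3 :=
  [set v | exists U phi x w,
     [/\ local_parametrization M U phi, U x, phi x = p & v = 'd phi x w]].

Definition radical (M : set 'rV[R]_3) (p : 'rV[R]_3) : set 'rV[R]_3 :=
  tangent_space M p `&` orthogonal_space (tangent_space M p).

Definition lightlike_surface (M : set 'rV[R]_3) : Prop :=
  surface M /\ forall p, M p -> radical M p <> [set 0].

(* Smoothness of a vector field given only on a subset A of R^3: locally it
   extends to a smooth field on an open set. *)
Definition smooth_along (A : set 'rV[R]_3) (X : 'rV[R]_3 -> 'rV[R]_3) : Prop :=
  forall q, A q -> exists (W : set 'rV[R]_3) (Y : 'rV[R]_3 -> 'rV[R]_3),
    [/\ open W, W q, smooth_on W Y & forall z, (A `&` W) z -> X z = Y z].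

(* A bundle over M is given by its fibres [L p] (only the points p of M
   matter); its local sections over M `&` V, for V open in R^3. *)
Definition local_section (M : set 'rV[R]_3) (L : 'rV[R]_3 -> set 'rV[R]_3)
    (V : set 'rV[R]_3) (X : 'rV[R]_3 -> 'rV[R]_3) : Prop :=
  [/\ open V, smooth_along (M `&` V) X & forall q, (M `&` V) q -> L q (X q)].

Definition nowhere_zero_section (M : set 'rV[R]_3)
    (L : 'rV[R]_3 -> set 'rV[R]_3) (V : set 'rV[R]_3)
    (X : 'rV[R]_3 -> 'rV[R]_3) : Prop :=
  local_section M L V X /\ forall q, (M `&` V) q -> X q != 0.

Definition line_bundle (M : set 'rV[R]_3)
    (L : 'rV[R]_3 -> set 'rV[R]_3) : Prop :=
  forall p, M p -> exists V X,
    [/\ V p, nowhere_zero_section M L V X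
      & forall q, (M `&` V) q -> L q = line (X q)].

Definition screen_distribution (M : set 'rV[R]_3)
    (S : 'rV[R]_3 -> set 'rV[R]_3) : Prop :=
  line_bundle M S /\
  forall p, M p ->
    radical M p `&` S p = [set 0] /\
    tangent_space M p = [set r + s | r in radical M p & s in S p].

Definition null_transversal_section (M : set 'rV[R]_3)
    (S tr : 'rV[R]_3 -> set 'rV[R]_3) (V : set 'rV[R]_3)
    (xi N : 'rV[R]_3 -> 'rV[R]_3) : Prop :=
  local_section M tr V N /\
  forall q, (M `&` V) q ->
    [/\ lorentz_form (N q) (xi q) = 1, lorentz_form (N q) (N q) = 0
      & forall w, S q w -> lorentz_form (N q) w = 0].

Definition lightlike_transversal_bundle (M : set 'rV[R]_3)
    (S tr : 'rV[R]_3 -> set 'rV[R]_3) : Prop :=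
  line_bundle M tr /\
  forall V xi, nowhere_zero_section M (radical M) V xi ->
    exists2 N, null_transversal_section M S tr V xi N &
      forall N', null_transversal_section M S tr V xi N' ->
        forall q, (M `&` V) q -> N' q = N q.

(* The affine plane E(p, v) through p directed by v and the fibre tr_p. *)
Definition section_plane (tr : 'rV[R]_3 -> set 'rV[R]_3) (p v : 'rV[R]_3) :
    set 'rV[R]_3 :=
  [set p + (a *: v + n) | a in setT & n in tr p].

(* gamma is the normal section of M at p = gamma 0 in the direction of xi,
   a section of the radical distribution near p: on an open interval around 0
   it is an integral curve of xi (hence lightlike), and its trace is the
   intersection of M with E(p, xi) in a neighbourhood of p. *)
Definition normal_section (M : set 'rV[R]_3) (tr : 'rV[R]_3 -> set 'rV[R]_3)
    (p : 'rV[R]_3) (V : set 'rV[R]_3) (xi : 'rV[R]_3 -> 'rV[R]_3)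
    (gamma : R -> 'rV[R]_3) : Prop :=
  exists (d : R) (W : set 'rV[R]_3),
    [/\ 0 < d,
        [/\ open W, W p & W `<=` V],
        smooth_on `]-d, d[ gamma,
        gamma 0 = p /\ forall t, t \in `]-d, d[ -> (gamma^`() t)%classic = xi (gamma t)
      & gamma @` `]-d, d[ = M `&` section_plane tr p (xi p) `&` W].

(* In R^3 with its flat connection, the covariant derivatives of gamma' along
   gamma are the ordinary derivatives of gamma. *)
Definition degenerate_planar_normal_sections (M : set 'rV[R]_3)
    (tr : 'rV[R]_3 -> set 'rV[R]_3) : Prop :=
  forall p V xi gamma,
    M p -> V p -> nowhere_zero_section M (radical M) V xi ->
    normal_section M tr p V xi gamma ->
    ~~ free [:: gamma^`(1) 0; gamma^`(2) 0; gamma^`(3) 0]%classic.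

End Geometry.

(* Main.v *)
Require Import Defs.
From HB Require Import structures.
From mathcomp Require Import all_boot all_order all_algebra.
From mathcomp Require Import all_classical all_reals all_analysis.

(** A normal section [gamma] at [p] lies, by construction, in the affine plane
    through [p] directed by [E], the span of [xi p] and of a generator of the
    fibre of the transversal line bundle at [p].  So the differences
    [gamma s - gamma t] all lie in the linear plane [E].  A linear subspace of
    a finite-dimensional space is closed, hence contains the limits of the
    difference quotients of a curve whose increments it contains
    ([derive1_vspace]); by induction every derivative of positive order of
    [gamma] lies in [E] ([derive1n_vspace]).  In particular [gamma'], [gamma'']
    and [gamma'''] at [0] are three vectors in a space of dimension at most
    two, so they are linearly dependent ([not_free_span]). *)

Set Implicit Arguments.
Unset Strict Implicit.
Unset Printing Implicit Defensive.
Import Order.TTheory GRing.Theory Num.Theory.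
Import numFieldNormedType.Exports.
Local Open Scope classical_set_scope.
Local Open Scope ring_scope.

Lemma continuous_linear_rV (R : realType) (n : nat) (W : normedModType R)
    (f : {linear 'rV[R]_n -> W}) : continuous f.
Proof.
have -> : (f : 'rV[R]_n -> W) =
    fun v => \sum_(j < n) v ord0 j *: f (delta_mx ord0 j).
  apply/funext => v; rewrite {1}[v]row_sum_delta linear_sum /=.
  by apply: eq_bigr => j _; rewrite linearZ.
apply: continuous_big; first exact: add_continuous.
by move=> j _ v; apply: (@cvgZr_tmp _ _ _ (nbhs v)); exact: coord_continuous.
Qed.

(** [E] is the zero set of the continuous linear map [v |-> v - projv E v]. *)
Lemma closed_vspace (R : realType) (n : nat) (E : {vspace 'rV[R]_n}) :
  closed [set v | v \in E].
Proof.
have -> : [set v | v \in E] = (\1 - projv E)%VF @^-1` [set 0].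
  apply/seteqP; split => v /=; rewrite add_lfunE opp_lfunE id_lfunE.
    by move=> /projv_id ->; rewrite subrr.
  by move=> /eqP; rewrite subr_eq0 => /eqP ->; exact: memv_proj.
apply: preimage_closed; first by move=> v _; exact: continuous_linear_rV.
exact/accessible_closed_set1/hausdorff_accessible/norm_hausdorff.
Qed.

(** The difference quotients of [f] at [t] lie in the closed set [E], hence so
    does their limit. *)
Lemma derive1_vspace (R : realType) (n : nat) (E : {vspace 'rV[R]_n})
    (U : set R) (f : R -> 'rV[R]_n) (t : R) :
  open U -> U t -> derivable f t 1 ->
  (forall s, U s -> f s - f t \in E) -> (f^`() t)%classic \in E.
Proof.
move=> oU Ut df fE; rewrite derive1E.
apply: (closed_cvg _ (@closed_vspace R n E) _ _ df).
apply: nbhs_dnbhs.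
have : \forall h \near (0 : R), U (h + t).
  have Unear : \near t, U t by exact: open_nbhs_nbhs.
  by rewrite (near_shift 0 t) subr0 in Unear.
by apply: filterS => h Uh /=; rewrite memvZ// [_%:A]mulr1 fE.
Qed.

Lemma smooth_on_derive1 (R : realType) (W : normedModType R) (U : set R)
    (f : R -> W) : smooth_on U f -> smooth_on U f^`()%classic.
Proof.
move=> fU n; have [_ /(_ 1)] := fU n.+1.
by congr Cn_on; apply/funext => t; rewrite derive1E.
Qed.

Lemma smooth_on_derivable (R : realType) (W : normedModType R) (U : set R)
    (f : R -> W) (t : R) : smooth_on U f -> U t -> derivable f t 1.
Proof. by move=> /(_ 1%N)[df _] /df; exact: diff_derivable. Qed.

(** Induction on the order: once [f'] takes its values in [E], the increments of
    [f'] lie in [E] too, so the hypothesis on [f] passes to [f']. *)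
Lemma derive1n_vspace (R : realType) (n : nat) (E : {vspace 'rV[R]_n})
    (U : set R) (f : R -> 'rV[R]_n) (k : nat) :
  open U -> smooth_on U f -> (forall s t, U s -> U t -> f s - f t \in E) ->
  forall t, U t -> (f^`(k.+1) t)%classic \in E.
Proof.
move=> oU; elim: k f => [|k IHk] f fU fE t Ut.
  by apply: (derive1_vspace oU Ut (smooth_on_derivable fU Ut)) => s /fE; exact.
rewrite derive1Sn; apply: IHk => //; first exact: smooth_on_derive1.
have fE' s : U s -> (f^`() s)%classic \in E.
  move=> Us; apply: (derive1_vspace oU Us (smooth_on_derivable fU Us)) => r Ur.
  exact: fE.
by move=> s r Us Ur; rewrite memvB ?fE'.
Qed.

Lemma not_free_span (K : fieldType) (V : vectType K) (X Y : seq V) :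
  (size Y < size X)%N -> {subset X <= <<Y>>%VS} -> ~~ free X.
Proof.
move=> YX /span_subvP/dimvS XY; apply/negP => /eqP dX.
by move: YX; rewrite ltnNge -dX (leq_trans XY) // dim_span.
Qed.

Theorem corollary3p1 (R : realType) (M : set 'rV[R]_3)
    (S tr : 'rV[R]_3 -> set 'rV[R]_3)
    (hM : lightlike_surface M)
    (hS : screen_distribution M S)
    (htr : lightlike_transversal_bundle M S tr) :
  degenerate_planar_normal_sections M tr.
Proof.
move=> p V xi gamma Mp _ _ [d [W [d0 _ gsmooth _ gtrace]]].
have [V' [X [V'p _ trX]]] := htr.1 p Mp.
have trp : tr p = line (X p) by exact: trX.
pose E := <<[:: xi p; X p]>>%VS.
have xiE : xi p \in E by rewrite memv_span// !inE eqxx.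
have XE : X p \in E by rewrite memv_span// !inE eqxx orbT.
have planeE q : section_plane tr p (xi p) q -> q - p \in E.
  move=> [a _ [w]]; rewrite trp => -[c _ <-] <-.
  by rewrite addrC addKr memvD ?memvZ.
have gpE (t : R) : t \in `]-d, d[ -> gamma t - p \in E.
  move=> td; apply: planeE.
  by have [[]] : (M `&` section_plane tr p (xi p) `&` W) (gamma t)
    by rewrite -gtrace; exists t.
have incrE (s t : R) : `]-d, d[%classic s -> `]-d, d[%classic t ->
    gamma s - gamma t \in E.
  by move=> /gpE sE /gpE tE; rewrite -(subrKA p) -[p - _]opprB memvB.
have derE k : (gamma^`(k.+1) 0)%classic \in E.
  apply: (derive1n_vspace k _ gsmooth incrE); first exact: interval_open.
  by rewrite /= in_itv /= oppr_lt0 d0.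
apply: (@not_free_span _ _ _ [:: xi p; X p]) => // v.
by rewrite !inE => /or3P[] /eqP ->; exact: derE.
Qed.
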